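(* Let $M$ be a commutative monoid and let $0\to\mathcal{A}'\xrightarrow{i}\mathcal{A}\xrightarrow{p}\mathcal{A}''\to0$ be a short exact sequence in $\mathcal{H}(M)$. There is a natural long exact sequence $$0\to\mathsf{D}^0(M,\mathcal{A}')\xrightarrow{i_*}\mathsf{D}^0(M,\mathcal{A})\xrightarrow{p_*}\mathsf{D}^0(M,\mathcal{A}'')\xrightarrow{\delta^0}\mathsf{D}^1(M,\mathcal{A}')\xrightarrow{i_*}\mathsf{D}^1(M,\mathcal{A})\xrightarrow{p_*}\mathsf{D}^1(M,\mathcal{A}'').$$
   Context: A system of abelian groups $\mathcal{A}$ over a commutative monoid $M$ consists of an abelian group $\mathcal{A}(a)$ for each $a\in M$ and homomorphisms $r_*:\mathcal{A}(a)\to\mathcal{A}(ra)$ for all $r,a\in M$ with $1_*=\mathrm{id}$ and $(rs)_*=r_*\circ s_*$. A morphism is a family of homomorphisms $\mathcal{A}(a)\to\mathcal{B}(a)$ commuting with all $r_*$; the category is $\mathcal{H}(M)$. A sequence in $\mathcal{H}(M)$ is short exact if it is a short exact sequence of abelian groups at each $a\in M$. $\mathsf{C}^0(M,\mathcal{A})$ is the group of functions $g$ with $g(a)\in\mathcal{A}(a)$; $\mathsf{C}^1(M,\mathcal{A})$ the group of functions $f$ with $f(a,b)\in\mathcal{A}(ab)$, $f(a,b)=f(b,a)$; $\mathsf{C}^2(M,\mathcal{A})$ the group of functions $h$ with $h(a,b,c)\in\mathcal{A}(abc)$, $h(a,b,c)-h(b,a,c)+h(b,c,a)=0$. The coboundaries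 are $$(\partial^0g)(a,b)=a_*g(b)-g(ab)+b_*g(a),\qquad(\partial^1f)(a,b,c)=a_*f(b,c)-f(ab,c)+f(a,bc)-c_*f(a,b).$$ $\mathsf{D}^0(M,\mathcal{A})=\ker\partial^0$ and $\mathsf{D}^1(M,\mathcal{A})=\ker\partial^1/\mathrm{im}\,\partial^0$; $i_*$, $p_*$ denote the maps induced by $i$, $p$. *)

(* Defs.v *)
From HB Require Import structures.
From mathcomp Require Import all_boot ssralg ring_quotient.
From mathcomp Require Import boolp classical_sets functions.

Set Implicit Arguments.
Unset Strict Implicit.
Unset Printing Implicit Defensive.

Import GRing.Theory.
Local Open Scope classical_set_scope.
Local Open Scope ring_scope.

HB.mixin Record Monoid_isCommutative M of Monoid M := {
  mulgC : commutative ( *%g : M -> M -> M)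
}.

#[short(type="comMonoidType")]
HB.structure Definition ComMonoid := {M of Monoid_isCommutative M & Monoid M}.

Section Dprod.
Variables (T : Type) (V : T -> zmodType).

(* The pointwise group structure on dependent functions; the library has it for
   non-dependent functions only. *)
Definition dprod := forall t, V t.

HB.instance Definition _ := gen_eqMixin dprod.
HB.instance Definition _ := gen_choiceMixin dprod.

Definition dprod_zero : dprod := fun=> 0.
Definition dprod_opp (f : dprod) : dprod := fun t => - f t.
Definition dprod_add (f g : dprod) : dprod := fun t => f t + g t.

Fact dprod_addA : associative dprod_add.
Proof. by move=> f g h; apply: functional_extensionality_dep => t; exact: addrA. Qed.
Fact dprod_addC : commutative dprod_add.
Proof. by move=> f g; apply: functional_extensionality_dep => t; exact: addrC. Qed.
Fact dprod_add0 : left_id dprod_zero dprod_add.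
Proof. by move=> f; apply: functional_extensionality_dep => t; exact: add0r. Qed.
Fact dprod_addN : left_inverse dprod_zero dprod_opp dprod_add.
Proof. by move=> f; apply: functional_extensionality_dep => t; exact: addNr. Qed.

HB.instance Definition _ :=
  GRing.isZmodule.Build dprod dprod_addA dprod_addC dprod_add0 dprod_addN.

Lemma dprodB (f g : dprod) t : (f - g) t = f t - g t. Proof. by []. Qed.
Lemma dprod0 t : (0 : dprod) t = 0. Proof. by []. Qed.

End Dprod.

Section Subgroup.
Variables (V : zmodType) (P : zmodClosed V).

Definition subgroup := {x : V | x \in P}.

HB.instance Definition _ := SubChoice.on subgroup.
HB.instance Definition _ :=
  GRing.SubChoice_isSubZmodule.Build V (mem P) subgroup (GRing.zmodClosedP P).

End Subgroup.

Section Homology.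
Variables (U V W : zmodType) (f : {additive U -> V}) (g : {additive V -> W}).

Definition ker_pred : {pred V} := fun x => g x == 0.

Fact ker_zmod_closed : zmod_closed ker_pred.
Proof.
split=> [|x y]; rewrite !unfold_in ?raddf0 // => /eqP gx /eqP gy.
by rewrite raddfB gx gy subrr.
Qed.
HB.instance Definition _ := GRing.isZmodClosed.Build V ker_pred ker_zmod_closed.

Definition ker := subgroup ker_pred.

(* The image of f, as a subgroup of the kernel of g (used only when g \o f = 0). *)
Definition im_pred : {pred ker} := fun z => `[< exists x, f x = val z >].

Fact im_zmod_closed : zmod_closed im_pred.
Proof.
split=> [|y z]; first by apply/asboolP; exists 0; rewrite !raddf0.
move=> /asboolP[x1 e1] /asboolP[x2 e2].
by apply/asboolP; exists (x1 - x2); rewrite !raddfB e1 e2.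
Qed.
HB.instance Definition _ := GRing.isZmodClosed.Build ker im_pred im_zmod_closed.

Definition homology := Quotient.quot im_pred.
End Homology.
Arguments im_pred {U V W} f g _ : simpl never.

Definition homology_class (U V W : zmodType) (f : {additive U -> V})
  (g : {additive V -> W}) : {additive ker g -> homology f g} := \pi_(homology f g)%qT.

Lemma homology_class_repr (U V W : zmodType) (f : {additive U -> V})
  (g : {additive V -> W}) (y : homology f g) : homology_class f g (repr y) = y.
Proof. exact: reprK. Qed.

Section KerMap.
Variables (V W V' W' : zmodType) (g : {additive V -> W}) (g' : {additive V' -> W'}).
Variables (v : {additive V -> V'}) (w : {additive W -> W'}).
Hypothesis gv : forall y, w (g y) = g' (v y).

Fact ker_map_subproof (z : ker g) : v (val z) \in ker_pred g'.
Proof. by rewrite unfold_in -gv (eqP (valP z)) raddf0. Qed.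

Definition ker_map (z : ker g) : ker g' := Sub (v (val z)) (ker_map_subproof z).

Fact ker_map_is_zmod_morphism : zmod_morphism ker_map.
Proof. by move=> y z; apply: val_inj; rewrite /= !raddfB. Qed.
HB.instance Definition _ :=
  GRing.isZmodMorphism.Build (ker g) (ker g') ker_map ker_map_is_zmod_morphism.

End KerMap.

Record chain_map (U V W U' V' W' : zmodType)
  (f : {additive U -> V}) (g : {additive V -> W})
  (f' : {additive U' -> V'}) (g' : {additive V' -> W'}) := ChainMap {
  chain_u : {additive U -> U'};
  chain_v : {additive V -> V'};
  chain_w : {additive W -> W'};
  chain_uv : forall x, chain_v (f x) = f' (chain_u x);
  chain_vw : forall y, chain_w (g y) = g' (chain_v y)
}.

Section HomologyMap.
Variables (U V W U' V' W' : zmodType).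
Variables (f : {additive U -> V}) (g : {additive V -> W}).
Variables (f' : {additive U' -> V'}) (g' : {additive V' -> W'}).
Variable phi : chain_map f g f' g'.

Definition homology_map (z : homology f g) : homology f' g' :=
  homology_class f' g' (ker_map (chain_vw phi) (repr z)).

Lemma homology_map_class (z : ker g) :
  homology_map (homology_class f g z) = homology_class f' g' (ker_map (chain_vw phi) z).
Proof.
rewrite /homology_map; set y := repr _.
have /asboolP[x fx] : y - z \in im_pred f g.
  by rewrite Quotient.idealrBE; apply/eqP; rewrite /y reprK.
apply/eqP; rewrite -Quotient.idealrBE; apply/asboolP.
by exists (chain_u phi x); rewrite -chain_uv fx !raddfB.
Qed.

Fact homology_map_is_zmod_morphism : zmod_morphism homology_map.
Proof.
move=> y z; rewrite -[y]homology_class_repr -[z]homology_class_repr.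
by rewrite -raddfB !homology_map_class !raddfB.
Qed.
HB.instance Definition _ :=
  GRing.isZmodMorphism.Build (homology f g) (homology f' g')
    homology_map homology_map_is_zmod_morphism.

End HomologyMap.

Definition exact_at (U V W : zmodType) (f : {additive U -> V}) (g : {additive V -> W}) :=
  range f = g @^-1` [set 0].

Definition short_exact (U V W : zmodType) (f : {additive U -> V}) (g : {additive V -> W}) :=
  [/\ f @^-1` [set 0] = [set 0], exact_at f g & range g = setT].

(* [transport A e] identifies the fibres of A over two provably equal indices,
   such as a * b and b * a, which need not be convertible. *)
Definition transport (M : Type) (A : M -> zmodType) (a b : M) (e : a = b) :
  A a -> A b := fun x => ecast c (A c) e x.
Arguments transport {M} A {a b} e x.

Fact transport_is_zmod_morphism (M : Type) (A : M -> zmodType) a b (e : a = b) :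
  zmod_morphism (transport A e).
Proof. by case: b / e. Qed.
HB.instance Definition _ (M : Type) (A : M -> zmodType) a b (e : a = b) :=
  GRing.isZmodMorphism.Build _ _ (transport A e) (transport_is_zmod_morphism e).

Record system (M : comMonoidType) := System {
  fibre :> M -> zmodType;
  push : forall r a, {additive fibre a -> fibre (r * a)%g};
  push1 : forall a (x : fibre a), transport fibre (mul1g a) (push 1%g a x) = x;
  pushM : forall r s a (x : fibre a),
    push (r * s)%g a x = transport fibre (mulgA r s a) (push r (s * a)%g (push s a x))
}.
Arguments push {M} A r {a} : rename.

Record hom (M : comMonoidType) (A B : system M) := Hom {
  hom_fun :> forall a, {additive A a -> B a};
  hom_push : forall r a (x : A a), hom_fun (r * a)%g (push A r x) = push B r (hom_fun a x)
}.

Section Cochains.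
Variables (M : comMonoidType) (A : system M).

Local Notation tr e x := (transport A e x).

Definition C0 := dprod A.

Definition fun2 := dprod (fun a => dprod (fun b => A (a * b)%g)).
Definition fun3 := dprod (fun a => dprod (fun b => dprod (fun c => A (a * b * c)%g))).

Definition C1_pred : {pred fun2} :=
  fun f => `[< forall a b, f a b = tr (mulgC b a) (f b a) >].

Fact C1_zmod_closed : zmod_closed C1_pred.
Proof.
split=> [|f g]; first by apply/asboolP => a b; rewrite raddf0.
move=> /asboolP fC /asboolP gC; apply/asboolP => a b.
by rewrite !dprodB fC gC raddfB.
Qed.
HB.instance Definition _ := GRing.isZmodClosed.Build fun2 C1_pred C1_zmod_closed.

Definition C1 := subgroup C1_pred.

Fact mulg_bac a b c : (b * a * c = a * b * c :> M)%g.
Proof. by rewrite (mulgC b). Qed.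
Fact mulg_bca a b c : (b * c * a = a * b * c :> M)%g.
Proof. by rewrite mulgC mulgA. Qed.

Definition C2_pred : {pred fun3} := fun h => `[< forall a b c,
  h a b c - tr (mulg_bac a b c) (h b a c) + tr (mulg_bca a b c) (h b c a) = 0 >].

Fact C2_zmod_closed : zmod_closed C2_pred.
Proof.
split=> [|f g]; first apply/asboolP => a b c.
  by rewrite -[LHS]/(0 - tr _ 0 + tr _ 0) !raddf0 !addr0.
move=> /asboolP fC /asboolP gC; apply/asboolP => a b c.
have := congr2 (fun x y => x - y) (fC a b c) (gC a b c).
rewrite subr0 !dprodB !raddfB /= => <-.
by rewrite !opprD !opprK !addrA [RHS](ACl (1*4*2*5*3*6)).
Qed.
HB.instance Definition _ := GRing.isZmodClosed.Build fun3 C2_pred C2_zmod_closed.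

Definition C2 := subgroup C2_pred.

(* In d0_fun and d1_fun every term is transported to the fibre over a * b,
   resp. a * b * c. *)
Definition d0_fun (g : C0) : fun2 := fun a b =>
  push A a (g b) - g (a * b)%g + tr (mulgC b a) (push A b (g a)).

Definition d1_fun (f : C1) : fun3 := fun a b c =>
  tr (mulgA a b c) (push A a (val f b c)) - val f (a * b)%g c
  + tr (mulgA a b c) (val f a (b * c)%g)
  - tr (mulgC c (a * b)%g) (push A c (val f a b)).

Lemma trK (a : M) (e : a = a) (x : A a) : tr e x = x.
Proof. by rewrite (eq_axiomK e). Qed.

Lemma tr_tr (a b c : M) (e : a = b) (e' : b = c) (x : A a) :
  tr e' (tr e x) = tr (etrans e e') x.
Proof. by case: c / e'; case: b / e. Qed.

Lemma tr_irr (a b : M) (e e' : a = b) (x : A a) : tr e x = tr e' x.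
Proof. by rewrite (eq_irrelevance e e'). Qed.

Lemma tr_subK (a b : M) (e e' : a = b) (x : A a) : tr e x - tr e' x = 0.
Proof. by rewrite (tr_irr e e') subrr. Qed.

Lemma tr_subKN (a b : M) (e e' : a = b) (x : A a) : - tr e x + tr e' x = 0.
Proof. by rewrite (tr_irr e e') addNr. Qed.

Lemma push_tr (r a b : M) (e : a = b) (x : A a) :
  push A r (tr e x) = tr (congr1 (fun c => (r * c)%g) e) (push A r x).
Proof. by case: b / e. Qed.

Lemma push_congr (r s a : M) (e : r = s) (x : A a) :
  push A s x = tr (congr1 (fun t => (t * a)%g) e) (push A r x).
Proof. by case: s / e. Qed.

Lemma push_push (r s a : M) (x : A a) :
  push A r (push A s x) = tr (esym (mulgA r s a)) (push A (r * s)%g x).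
Proof. by rewrite pushM tr_tr trK. Qed.

Lemma fun1_congr (g : C0) (a b : M) (e : a = b) : g b = tr e (g a).
Proof. by case: b / e. Qed.

Lemma fun2_congr (f : fun2) (a a' b b' : M) (e : a = a') (e' : b = b') :
  f a' b' = tr (congr2 (fun x y => (x * y)%g) e e') (f a b).
Proof. by case: a' / e; case: b' / e'; rewrite trK. Qed.


Fact d0_sym (g : C0) : d0_fun g \in C1_pred.
Proof.
apply/asboolP => a b; rewrite /d0_fun !raddfD !raddfN /= tr_tr trK.
rewrite -(fun1_congr g) [RHS](ACl (3*2*1)) /=.
congr (_ - _ + _); exact: tr_irr.
Qed.
Definition d0 (g : C0) : C1 := Sub (d0_fun g) (d0_sym g).

Fact d0_is_zmod_morphism : zmod_morphism d0.
Proof.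
move=> f g; apply: val_inj.
apply: functional_extensionality_dep => a; apply: functional_extensionality_dep => b.
rewrite /= !dprodB /d0_fun !dprodB !raddfB /=.
by rewrite !opprD !opprK !addrA [RHS](ACl (1*4*2*5*3*6)).
Qed.
HB.instance Definition _ := GRing.isZmodMorphism.Build C0 C1 d0 d0_is_zmod_morphism.

Lemma C1C (f : C1) a b : val f a b = tr (mulgC b a) (val f b a).
Proof. by have /asboolP := valP f; apply. Qed.

Fact d1_C2 (f : C1) : d1_fun f \in C2_pred.
Proof.
apply/asboolP => a b c; rewrite /d1_fun !raddfD !raddfN /=.
rewrite !tr_tr.
rewrite (C1C f a (b * c)%g) (C1C f c a) [in X in push A c X](C1C f a b).
rewrite (fun2_congr (val f) (mulgC b a) (erefl c)).
rewrite (fun2_congr (val f) (erefl b) (mulgC a c)).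
rewrite !push_tr !tr_tr !(addrA, opprD, opprK) /=.
rewrite [LHS](ACl ((1*12)*(2*6)*(3*10)*(4*8)*(5*9)*(7*11))) /=.
by rewrite !(tr_subK, tr_subKN) !addr0.
Qed.
Definition d1 (f : C1) : C2 := Sub (d1_fun f) (d1_C2 f).

Fact d1_is_zmod_morphism : zmod_morphism d1.
Proof.
move=> f g; apply: val_inj; apply: functional_extensionality_dep => a.
apply: functional_extensionality_dep => b; apply: functional_extensionality_dep => c.
have E x y : val (f - g) x y = val f x y - val g x y by [].
rewrite /= !dprodB /d1_fun !E !raddfB /=.
rewrite !(addrA, opprD, opprK).
by rewrite [LHS](ACl (1*3*5*7*2*4*6*8)).
Qed.
HB.instance Definition _ := GRing.isZmodMorphism.Build C1 C2 d1 d1_is_zmod_morphism.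

Lemma d1_d0 (g : C0) : d1 (d0 g) = 0.
Proof.
apply: val_inj; apply: functional_extensionality_dep => a.
apply: functional_extensionality_dep => b; apply: functional_extensionality_dep => c.
rewrite /= !dprod0 /d1_fun /= /d0_fun !raddfD !raddfN /= !push_tr !tr_tr.
rewrite !push_push (push_congr (mulgC c a)) (push_congr (mulgC c b)) !tr_tr.
rewrite (fun1_congr g (mulgA a b c)) !(addrA, opprD, opprK) trK.
rewrite [LHS](ACl ((1*4)*(2*7)*(3*10)*(5*8)*(6*11)*(9*12))) /=.
by rewrite subrr !(tr_subK, tr_subKN) !addr0.
Qed.

Definition D0 := ker d0.
Definition D1 := homology d0 d1.

End Cochains.
Arguments C1_pred {M} A _.
Arguments C2_pred {M} A _.

Section Functoriality.
Variables (M : comMonoidType) (A B : system M) (phi : hom A B).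

Lemma hom_tr a b (e : a = b) (x : A a) :
  phi b (transport A e x) = transport B e (phi a x).
Proof. by case: b / e. Qed.

Definition C0_map (g : C0 A) : C0 B := fun a => phi a (g a).

Fact C0_map_is_zmod_morphism : zmod_morphism C0_map.
Proof.
by move=> f g; apply: functional_extensionality_dep => a; exact: raddfB.
Qed.
HB.instance Definition _ :=
  GRing.isZmodMorphism.Build (C0 A) (C0 B) C0_map C0_map_is_zmod_morphism.

Definition fun2_map (f : fun2 A) : fun2 B := fun a b => phi (a * b)%g (f a b).

Fact C1_map_subproof (f : C1 A) : fun2_map (val f) \in C1_pred B.
Proof. by apply/asboolP => a b; rewrite -hom_tr -C1C. Qed.
Definition C1_map (f : C1 A) : C1 B := Sub (fun2_map (val f)) (C1_map_subproof f).

Fact C1_map_is_zmod_morphism : zmod_morphism C1_map.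
Proof.
move=> f g; apply: val_inj; apply: functional_extensionality_dep => a.
by apply: functional_extensionality_dep => b; exact: raddfB.
Qed.
HB.instance Definition _ :=
  GRing.isZmodMorphism.Build (C1 A) (C1 B) C1_map C1_map_is_zmod_morphism.

Definition fun3_map (h : fun3 A) : fun3 B :=
  fun a b c => phi (a * b * c)%g (h a b c).

Fact C2_map_subproof (h : C2 A) : fun3_map (val h) \in C2_pred B.
Proof.
apply/asboolP => a b c; rewrite -!hom_tr -raddfB -raddfD.
by have /asboolP -> := valP h; rewrite raddf0.
Qed.
Definition C2_map (h : C2 A) : C2 B := Sub (fun3_map (val h)) (C2_map_subproof h).

Fact C2_map_is_zmod_morphism : zmod_morphism C2_map.
Proof.
move=> f g; apply: val_inj; apply: functional_extensionality_dep => a.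
apply: functional_extensionality_dep => b.
by apply: functional_extensionality_dep => c; exact: raddfB.
Qed.
HB.instance Definition _ :=
  GRing.isZmodMorphism.Build (C2 A) (C2 B) C2_map C2_map_is_zmod_morphism.

Lemma d0_map (g : C0 A) : C1_map (d0 g) = d0 (C0_map g).
Proof.
apply: val_inj; apply: functional_extensionality_dep => a.
apply: functional_extensionality_dep => b.
by rewrite /= /fun2_map /d0_fun raddfD raddfB /= hom_tr !hom_push.
Qed.

Lemma d1_map (f : C1 A) : C2_map (d1 f) = d1 (C1_map f).
Proof.
apply: val_inj; apply: functional_extensionality_dep => a.
apply: functional_extensionality_dep => b; apply: functional_extensionality_dep => c.
by rewrite /= /fun3_map /d1_fun !(raddfD, raddfN) /= !hom_tr !hom_push.
Qed.

Definition D0_map : {additive D0 A -> D0 B} := ker_map d0_map.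
Definition D1_map : {additive D1 A -> D1 B} := homology_map (ChainMap d0_map d1_map).

End Functoriality.

Record ses (M : comMonoidType) := Ses {
  ses_l : system M;
  ses_m : system M;
  ses_r : system M;
  ses_i : hom ses_l ses_m;
  ses_p : hom ses_m ses_r;
  ses_exact : forall a, short_exact (ses_i a) (ses_p a)
}.

Record ses_hom (M : comMonoidType) (S T : ses M) := SesHom {
  ses_hom_l : hom (ses_l S) (ses_l T);
  ses_hom_m : hom (ses_m S) (ses_m T);
  ses_hom_r : hom (ses_r S) (ses_r T);
  ses_hom_i : forall a x, ses_hom_m a (ses_i S a x) = ses_i T a (ses_hom_l a x);
  ses_hom_p : forall a x, ses_hom_r a (ses_p S a x) = ses_p T a (ses_hom_m a x)
}.

(* Main.v *)
From HB Require Import structures.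
Require Import Defs.
From mathcomp Require Import all_boot ssralg ring_quotient.
From mathcomp Require Import boolp classical_sets functions.

Set Implicit Arguments.
Unset Strict Implicit.
Unset Printing Implicit Defensive.

Import GRing.Theory.
Local Open Scope classical_set_scope.
Local Open Scope ring_scope.

(** The groups D^0 and D^1 are the kernel and the homology of the three-term
    complex C^0 -> C^1 -> C^2, and a short exact sequence of systems induces maps
    of these complexes; the six-term sequence is the start of their long exact
    homology sequence. Exactness of the columns is checked pointwise. In degree 0
    a cochain is an arbitrary family of elements, so preimages can be chosen
    index by index and the column is short exact. In degree 1 the cochains are
    symmetric; an element in the kernel of p lifts index by index along the
    injection i, and its lift is again symmetric because i is injective
    ([C1_lift]). The snake lemma lifts only 0-cochains along p, so this left
    exactness in degree 1, with injectivity of i in degree 2, is what feeds it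
    ([ses_exact_columns]).

    The connecting map sends x in the kernel of d0 over the right system to the
    class of z, where u is any lift of x to the middle and z is the 1-cochain
    with i z = d0 u. This is set up as a relation between x and the class of z
    ([connects]) that is total, additive and single-valued
    ([connects_total], [connectsB], [connects_unique]). Once it is known that any
    zigzag computes the map ([connectingE]), exactness and naturality
    ([connecting_natural]) follow by exhibiting zigzags. *)

(** * Elementwise forms of exactness *)

Lemma exact_atP (U V W : zmodType) (f : {additive U -> V})
    (g : {additive V -> W}) :
  exact_at f g <-> forall y, g y = 0 <-> exists x, f x = y.
Proof.
split=> [fg y|fg].
  have -> : (g y = 0) = (g @^-1` [set 0]) y by [].
  by rewrite -fg; split=> [[x _ <-]|[x <-]]; exists x.
apply/seteqP; split=> y /=.
  by case=> x _ <-; apply/fg; exists x.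
by move/fg => [x <-]; exists x.
Qed.

Lemma ker0P (U V : zmodType) (f : {additive U -> V}) :
  f @^-1` [set 0] = [set 0] <-> injective f.
Proof.
split=> [f0 x y fxy|f_inj].
  apply/eqP; rewrite -subr_eq0; apply/eqP.
  have : (f @^-1` [set 0]) (x - y) by rewrite /= raddfB fxy subrr.
  by rewrite f0.
apply/seteqP; split=> x /= => [fx0|->]; last exact: raddf0.
by apply: f_inj; rewrite raddf0.
Qed.

Lemma homology_class_eq (U V W : zmodType) (f : {additive U -> V})
    (g : {additive V -> W}) (y z : ker g) :
  homology_class f g y = homology_class f g z <-> exists x, f x = val y - val z.
Proof.
split=> [/eqP|[x fx]].
  by rewrite -Quotient.idealrBE => /asboolP[x fx]; exists x; rewrite fx raddfB.
by apply/eqP; rewrite -Quotient.idealrBE; apply/asboolP; exists x; rewrite fx raddfB.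
Qed.

Lemma homology_class_eq0 (U V W : zmodType) (f : {additive U -> V})
    (g : {additive V -> W}) (y : ker g) :
  homology_class f g y = 0 <-> exists x, f x = val y.
Proof.
by have := homology_class_eq f y 0; rewrite !raddf0 addr0.
Qed.

Lemma ker_valP (V W : zmodType) (g : {additive V -> W}) (z : ker g) :
  g (val z) = 0.
Proof. exact/eqP/(valP z). Qed.

Lemma ker_lift (V W : zmodType) (g : {additive V -> W}) (y : V) :
  g y = 0 -> exists z : ker g, val z = y.
Proof. by move=> /eqP gy; exists (Sub y gy). Qed.

(** * The connecting homomorphism *)

Section Connecting.
Variables (U' V' W' U V W U'' V'' W'' : zmodType).
Variables (f' : {additive U' -> V'}) (g' : {additive V' -> W'}).
Variables (f : {additive U -> V}) (g : {additive V -> W}).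
Variables (f'' : {additive U'' -> V''}) (g'' : {additive V'' -> W''}).
Variables (i : chain_map f' g' f g) (p : chain_map f g f'' g'').

(** The lifts of the snake lemma are taken in degree 0 and compared in degree 1,
    so degree 0 carries a full short exact sequence, degree 1 a left exact one,
    and in degree 2 injectivity is enough to recognize the cycles of the left
    complex. *)
Record exact_columns : Prop := ExactColumns {
  col_complex : forall u, g (f u) = 0;
  col_u : short_exact (chain_u i) (chain_u p);
  col_v_inj : injective (chain_v i);
  col_v : exact_at (chain_v i) (chain_v p);
  col_w_inj : injective (chain_w i)
}.

(** The zigzag of the snake lemma, kept as a relation so that additivity,
    naturality and exactness can each be checked on convenient lifts. *)
Definition connects (x : ker f'') (y : homology f' g') :=
  exists u z, [/\ chain_u p u = val x, chain_v i (val z) = f u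
                & homology_class f' g' z = y].

Lemma connectsB x1 x2 y1 y2 :
  connects x1 y1 -> connects x2 y2 -> connects (x1 - x2) (y1 - y2).
Proof.
move=> [u1 [z1 [pu1 iz1 <-]]] [u2 [z2 [pu2 iz2 <-]]].
by exists (u1 - u2), (z1 - z2); rewrite !raddfB pu1 pu2 iz1 iz2.
Qed.

Hypothesis H : exact_columns.

Let u_inj : injective (chain_u i). Proof. by case: (col_u H) => /ker0P. Qed.
Let u_exact y : chain_u p y = 0 <-> exists x, chain_u i x = y.
Proof. by case: (col_u H) => _ /exact_atP. Qed.
Let v_exact y : chain_v p y = 0 <-> exists x, chain_v i x = y.
Proof. by have /exact_atP := col_v H. Qed.
Let u_surj u'' : exists u, chain_u p u = u''.
Proof.
case: (col_u H) => _ _ pT.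
have [u _ <-] : range (chain_u p) u'' by rewrite pT.
by exists u.
Qed.

(** Injectivity on W' reflects the cycle condition from V back to V'. *)
Lemma cycle_of_image v' : g (chain_v i v') = 0 -> exists z : ker g', val z = v'.
Proof.
move=> giv; apply: ker_lift; apply: (col_w_inj H).
by rewrite chain_vw giv raddf0.
Qed.

Lemma connects_total x : exists y, connects x y.
Proof.
have [u pu] := u_surj (val x).
have [v' iv'] : exists v', chain_v i v' = f u.
  by apply/v_exact; rewrite chain_uv pu ker_valP.
have [z zv'] : exists z : ker g', val z = v'.
  by apply: cycle_of_image; rewrite iv' (col_complex H).
by exists (homology_class f' g' z), u, z; rewrite zv'.
Qed.

(** By additivity only the zigzags from 0 matter; there the lift comes from U',
    so the resulting cycle is its boundary. *)
Lemma connects_unique x y1 y2 : connects x y1 -> connects x y2 -> y1 = y2.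
Proof.
move=> xy1 xy2; apply/eqP; rewrite -subr_eq0; apply/eqP.
have := connectsB xy1 xy2; rewrite subrr => -[u [z [pu iz <-]]].
have [u' iu'] : exists u', chain_u i u' = u by apply/u_exact.
apply/homology_class_eq0; exists u'; apply: (col_v_inj H).
by rewrite chain_uv iu' iz.
Qed.

Definition connecting (x : ker f'') : homology f' g' :=
  projT1 (cid (connects_total x)).

Lemma connecting_connects x : connects x (connecting x).
Proof. exact: projT2 (cid (connects_total x)). Qed.

Lemma connectingE x y : connects x y -> connecting x = y.
Proof. exact: connects_unique (connecting_connects x). Qed.

Fact connecting_is_zmod_morphism : zmod_morphism connecting.
Proof.
by move=> x1 x2; apply: connectingE; apply: connectsB; exact: connecting_connects.
Qed.
HB.instance Definition _ :=
  GRing.isZmodMorphism.Build (ker f'') (homology f' g')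
    connecting connecting_is_zmod_morphism.

(** * Exactness of the six-term sequence *)

Lemma ker_map_inj : injective (ker_map (chain_uv i)).
Proof. by move=> x y /(congr1 val) /u_inj /val_inj. Qed.

Lemma exact_ker_middle : exact_at (ker_map (chain_uv i)) (ker_map (chain_uv p)).
Proof.
apply/exact_atP => y; split=> [/(congr1 val) /= /u_exact[u' iu']|[x <-]].
  have [x xu'] : exists x : ker f', val x = u'.
    by apply: ker_lift; apply: (col_v_inj H); rewrite chain_uv iu' ker_valP raddf0.
  by exists x; apply: val_inj; rewrite /= xu'.
by apply: val_inj; rewrite /=; apply/u_exact; exists (val x).
Qed.

Lemma exact_ker_right : exact_at (ker_map (chain_uv p)) connecting.
Proof.
apply/exact_atP => x; split=> [|[k <-]]; last first.
  by apply: connectingE; exists (val k), 0; rewrite /= !raddf0 ker_valP.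
rewrite /=; have [u [z [pu iz <-]]] := connecting_connects x.
move=> /homology_class_eq0[u' fu'].
(* z bounds u', so correcting the lift u by u' makes it a cycle over x *)
have [k ku] : exists k : ker f, val k = u - chain_u i u'.
  by apply: ker_lift; rewrite raddfB -iz -fu' chain_uv subrr.
exists k; apply: val_inj; rewrite /= ku raddfB pu.
suff -> : chain_u p (chain_u i u') = 0 by rewrite subr0.
by apply/u_exact; exists u'.
Qed.

Lemma exact_homology_left : exact_at connecting (homology_map i).
Proof.
apply/exact_atP => y; split=> [|[x <-]]; last first.
  rewrite /=; have [u [z [pu iz <-]]] := connecting_connects x.
  by rewrite homology_map_class; apply/homology_class_eq0; exists u.
rewrite /= -[y]homology_class_repr homology_map_class.
move=> /homology_class_eq0[u /= fu].
have [x xu] : exists x : ker f'', val x = chain_u p u.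
  by apply: ker_lift; rewrite -chain_uv fu; apply/v_exact; exists (val (repr y)).
by exists x; apply: connectingE; exists u, (repr y); rewrite xu.
Qed.

Lemma exact_homology_middle : exact_at (homology_map i) (homology_map p).
Proof.
apply/exact_atP => y; split=> [|[x <-]]; last first.
  rewrite /= -[x]homology_class_repr !homology_map_class.
  apply/homology_class_eq0; exists 0; rewrite raddf0 /=.
  by apply: esym; apply/v_exact; exists (val (repr x)).
rewrite /= -{1}[y]homology_class_repr homology_map_class.
move=> /homology_class_eq0[u'' /= fu''].
have [u pu] := u_surj u''.
(* subtracting the boundary of a lift of u'' moves the cycle into the image *)
have [v' iv'] : exists v', chain_v i v' = val (repr y) - f u.
  by apply/v_exact; rewrite raddfB chain_uv pu fu'' subrr.
have [z zv'] : exists z : ker g', val z = v'.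
  by apply: cycle_of_image; rewrite iv' raddfB ker_valP (col_complex H) subrr.
exists (homology_class f' g' z).
rewrite homology_map_class -[RHS]homology_class_repr.
apply/homology_class_eq; exists (- u); rewrite /= zv' iv' raddfN.
by rewrite addrAC subrr add0r.
Qed.

End Connecting.

(** * Naturality *)

Section Naturality.
Variables (U' V' W' U V W U'' V'' W'' : zmodType).
Variables (f' : {additive U' -> V'}) (g' : {additive V' -> W'}).
Variables (f : {additive U -> V}) (g : {additive V -> W}).
Variables (f'' : {additive U'' -> V''}) (g'' : {additive V'' -> W''}).
Variables (i : chain_map f' g' f g) (p : chain_map f g f'' g'').
Variables (X' Y' Z' X Y Z X'' Y'' Z'' : zmodType).
Variables (h' : {additive X' -> Y'}) (k' : {additive Y' -> Z'}).
Variables (h : {additive X -> Y}) (k : {additive Y -> Z}).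
Variables (h'' : {additive X'' -> Y''}) (k'' : {additive Y'' -> Z''}).
Variables (j : chain_map h' k' h k) (q : chain_map h k h'' k'').
Variables (l : chain_map f' g' h' k') (m : chain_map f g h k).
Variable r : chain_map f'' g'' h'' k''.

Lemma ker_map_square (mp : forall u, chain_u r (chain_u p u) = chain_u q (chain_u m u))
    (x : ker f) :
  ker_map (chain_uv r) (ker_map (chain_uv p) x)
  = ker_map (chain_uv q) (ker_map (chain_uv m) x).
Proof. by apply: val_inj; rewrite /= mp. Qed.

Lemma homology_map_square
    (mp : forall v, chain_v r (chain_v p v) = chain_v q (chain_v m v))
    (x : homology f g) :
  homology_map r (homology_map p x) = homology_map q (homology_map m x).
Proof.
rewrite -[x]homology_class_repr !homology_map_class; congr (homology_class _ _ _).
by apply: val_inj; rewrite /= mp.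
Qed.

Lemma connecting_natural (H : exact_columns i p) (K : exact_columns j q)
    (mi : forall v, chain_v m (chain_v i v) = chain_v j (chain_v l v))
    (rp : forall u, chain_u r (chain_u p u) = chain_u q (chain_u m u)) x :
  homology_map l (connecting H x) = connecting K (ker_map (chain_uv r) x).
Proof.
have [u [z [pu iz <-]]] := connecting_connects H x.
apply/esym/connectingE; exists (chain_u m u), (ker_map (chain_vw l) z).
by rewrite homology_map_class /= -rp pu -mi iz chain_uv.
Qed.

End Naturality.

(** * Cochains of a short exact sequence of systems *)

Section CochainMaps.
Variables (M : comMonoidType) (A B : system M) (phi : hom A B).

Definition cochain_map : chain_map (@d0 M A) (@d1 M A) (@d0 M B) (@d1 M B) :=
  ChainMap (d0_map phi) (d1_map phi).

Hypothesis phi_inj : forall a, injective (phi a).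

Lemma C0_map_inj : injective (C0_map phi).
Proof.
move=> g1 g2 e; apply: functional_extensionality_dep => a; apply: phi_inj.
exact: (congr1 (fun g : C0 B => g a) e).
Qed.

Lemma C1_map_inj : injective (C1_map phi).
Proof.
move=> f1 f2 /(congr1 val) e; apply: val_inj.
apply: functional_extensionality_dep => a.
apply: functional_extensionality_dep => b; apply: phi_inj.
exact: (congr1 (fun f : fun2 B => f a b) e).
Qed.

Lemma C2_map_inj : injective (C2_map phi).
Proof.
move=> h1 h2 /(congr1 val) e; apply: val_inj.
apply: functional_extensionality_dep => a.
apply: functional_extensionality_dep => b.
apply: functional_extensionality_dep => c; apply: phi_inj.
exact: (congr1 (fun h : fun3 B => h a b c) e).
Qed.

(** Over an injective morphism the symmetry of a 1-cochain is inherited by any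
    pointwise preimage. *)
Lemma C1_lift (f : C1 B) :
  (forall a b, exists x, phi (a * b)%g x = val f a b) ->
  exists f', C1_map phi f' = f.
Proof.
move=> lift; pose f' : fun2 A := fun a b => projT1 (cid (lift a b)).
have f'E a b : phi (a * b)%g (f' a b) = val f a b.
  exact: projT2 (cid (lift a b)).
have f'C : f' \in C1_pred A.
  by apply/asboolP => a b; apply: phi_inj; rewrite hom_tr !f'E -C1C.
exists (Sub f' f'C); apply: val_inj.
apply: functional_extensionality_dep => a.
by apply: functional_extensionality_dep => b; exact: f'E.
Qed.

End CochainMaps.

Lemma C0_lift (M : comMonoidType) (A B : system M) (phi : hom A B) (g : C0 B) :
  (forall a, exists x, phi a x = g a) -> exists g', C0_map phi g' = g.
Proof.
move=> lift; exists (fun a => projT1 (cid (lift a))).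
apply: functional_extensionality_dep => a; exact: projT2 (cid (lift a)).
Qed.

Section SesCochains.
Variables (M : comMonoidType) (S : ses M).

Let i_inj a : injective (ses_i S a).
Proof. by apply/ker0P; case: (ses_exact S a). Qed.
Let ip_exact a y : ses_p S a y = 0 <-> exists x, ses_i S a x = y.
Proof. by case: (ses_exact S a) => _ /exact_atP. Qed.

Lemma C0_short_exact : short_exact (C0_map (ses_i S)) (C0_map (ses_p S)).
Proof.
split.
- exact/ker0P/C0_map_inj.
- apply/exact_atP => g; split=> [pg|[g' <-]].
    apply: C0_lift => a; apply/ip_exact.
    exact: (congr1 (fun g : C0 _ => g a) pg).
  apply: functional_extensionality_dep => a.
  by apply/ip_exact; exists (g' a).
- apply/seteqP; split=> // g _.
  have [a|g0 <-] := @C0_lift _ _ _ (ses_p S) g; last by exists g0.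
  case: (ses_exact S a) => _ _ pT.
  have [x _ <-] : range (ses_p S a) (g a) by rewrite pT.
  by exists x.
Qed.

Lemma C1_exact : exact_at (C1_map (ses_i S)) (C1_map (ses_p S)).
Proof.
apply/exact_atP => f; split=> [/(congr1 val) pf|[f' <-]].
  apply: C1_lift => // a b; apply/ip_exact.
  exact: (congr1 (fun f : fun2 _ => f a b) pf).
apply: val_inj; apply: functional_extensionality_dep => a.
apply: functional_extensionality_dep => b.
by apply/ip_exact; exists (val f' a b).
Qed.

Lemma ses_exact_columns :
  exact_columns (cochain_map (ses_i S)) (cochain_map (ses_p S)).
Proof.
split; first exact: d1_d0.
- exact: C0_short_exact.
- exact: C1_map_inj.
- exact: C1_exact.
- exact: C2_map_inj.
Qed.

End SesCochains.

Section Squares.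
Variables (M : comMonoidType) (A B A1 B1 : system M).
Variables (p : hom A B) (q : hom A1 B1) (m : hom A A1) (r : hom B B1).
Hypothesis rp : forall a x, r a (p a x) = q a (m a x).

Lemma C0_map_square g : C0_map r (C0_map p g) = C0_map q (C0_map m g).
Proof. by apply: functional_extensionality_dep => a; exact: rp. Qed.

Lemma C1_map_square f : C1_map r (C1_map p f) = C1_map q (C1_map m f).
Proof.
apply: val_inj; apply: functional_extensionality_dep => a.
by apply: functional_extensionality_dep => b; exact: rp.
Qed.

Lemma D0_map_square x : D0_map r (D0_map p x) = D0_map q (D0_map m x).
Proof.
exact: (ker_map_square (p := cochain_map p) (q := cochain_map q)
  (m := cochain_map m) (r := cochain_map r) C0_map_square).
Qed.

Lemma D1_map_square x : D1_map r (D1_map p x) = D1_map q (D1_map m x).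
Proof.
exact: (homology_map_square (p := cochain_map p) (q := cochain_map q)
  (m := cochain_map m) (r := cochain_map r) C1_map_square).
Qed.

End Squares.

Theorem proposition4p3 (M : comMonoidType) :
  exists delta : forall S : ses M, {additive D0 (ses_r S) -> D1 (ses_l S)},
    (forall S : ses M,
      [/\ D0_map (ses_i S) @^-1` [set 0] = [set 0],
          exact_at (D0_map (ses_i S)) (D0_map (ses_p S)),
          exact_at (D0_map (ses_p S)) (delta S),
          exact_at (delta S) (D1_map (ses_i S)) &
          exact_at (D1_map (ses_i S)) (D1_map (ses_p S))]) /\
    (forall (S T : ses M) (phi : ses_hom S T),
      [/\ forall x, D0_map (ses_hom_m phi) (D0_map (ses_i S) x)
                    = D0_map (ses_i T) (D0_map (ses_hom_l phi) x),
          forall x, D0_map (ses_hom_r phi) (D0_map (ses_p S) x)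
                    = D0_map (ses_p T) (D0_map (ses_hom_m phi) x),
          forall x, D1_map (ses_hom_l phi) (delta S x)
                    = delta T (D0_map (ses_hom_r phi) x),
          forall x, D1_map (ses_hom_m phi) (D1_map (ses_i S) x)
                    = D1_map (ses_i T) (D1_map (ses_hom_l phi) x) &
          forall x, D1_map (ses_hom_r phi) (D1_map (ses_p S) x)
                    = D1_map (ses_p T) (D1_map (ses_hom_m phi) x)]).
Proof.
exists (fun S => connecting (ses_exact_columns S)); split=> [S|S T phi].
  move: (ses_exact_columns S) => H; split.
  - exact/ker0P/(ker_map_inj H).
  - exact: (exact_ker_middle H).
  - exact: (exact_ker_right H).
  - exact: (exact_homology_left H).
  - exact: (exact_homology_middle H).
split.
- exact/D0_map_square/ses_hom_i.
- exact/D0_map_square/ses_hom_p.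
- apply: (connecting_natural (l := cochain_map (ses_hom_l phi))
    (m := cochain_map (ses_hom_m phi)) (r := cochain_map (ses_hom_r phi))).
  + exact/C1_map_square/ses_hom_i.
  + exact/C0_map_square/ses_hom_p.
- exact/D1_map_square/ses_hom_i.
- exact/D1_map_square/ses_hom_p.
Qed.
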